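(* Let $\mathbf{C}\subseteq\mathbb{R}^n$ be a nonempty closed convex set and let $F=(F_1,\dots,F_m):\mathbb{R}^n\to\mathbb{R}^m$ be differentiable with Jacobian satisfying $\|\nabla F(x)-\nabla F(y)\|\le L_F\|x-y\|$ for all $x,y\in\mathbf{C}$, where $L_F>0$. Let $f(x)=\|F(x)\|+I_{\mathbf{C}}(x)$ and assume that the problem $\min_{x\in\mathbb{R}^n} f(x)$ has a solution $x^*\in\mathbf{C}$. Let $(x_k)_{k\ge 0}$ be a sequence generated by the MPG-N algorithm with parameters $L_0,\delta>0$ and starting point $x_0\in\mathbf{C}$ (see context), and let $\Omega(x_0)$ be the set of limit points of $(x_k)_{k\ge0}$. Assume additionally that $f$ satisfies the Kurdyka-Lojasiewicz (KL) property with exponent $q>0$ on $\Omega(x_0)$ (see context; in particular $\Omega(x_0)$ is nonempty and compact and $f$ takes a constant value $f_*$ on it). Then the following convergence rates hold in function values: (i) If $q\ge 2$, then $f(x_k)$ converges to $f_*$ linearly for $k$ sufficiently large, i.e., $f(x_k)\to f_*$ and there exist $\rho\in(0,1)$ and $k_0$ such that $f(x_{k+1})-f_*\le\rho\,(f(x_k)-f_* )$ for all $k\ge k_0$. (ii) If $q<2$, then $f(x_k)$ converges to $f_*$ at a sublinear rate of order $\mathcal{O}\left(\frac{1}{k^{\frac{q}{2-q}}}\right)$ for $k$ sufficiently large, i.e., there exist $c>0$ and $k_0\ge 1$ such that $0\le f(x_k)-f_*\le c\,k^{-\frac{q}{2-q}}$ for all $k\ge k_0$.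
   Context: Notation. $\|\cdot\|$ is the Euclidean norm on vectors and the induced operator norm on matrices. $I_{\mathbf{C}}$ is the indicator function of $\mathbf{C}$ ($0$ on $\mathbf{C}$, $+\infty$ outside). $\nabla F(x)$ is the $m\times n$ Jacobian matrix. Subdifferential: for a proper lower semicontinuous $f:\mathbb{R}^n\to\mathbb{R}\cup\{+\infty\}$ and $x\in\mathrm{dom}\,f$, the Fréchet subdifferential $\widehat{\partial}f(x)$ is the set of $g\in\mathbb{R}^n$ with $\liminf_{y\to x,\,y\ne x}\frac{f(y)-f(x)-\langle g,y-x\rangle}{\|y-x\|}\ge 0$, and $\widehat{\partial}f(x)=\emptyset$ if $x\notin\mathrm{dom}\,f$. The (limiting) subdifferential $\partial f(x)$ is the set of $g$ for which there exist $x^k\to x$ with $f(x^k)\to f(x)$ and $g^k\in\widehat{\partial}f(x^k)$ with $g^k\to g$. Put $S_f(x)=\mathrm{dist}(0,\partial f(x))=\inf_{g\in\partial f(x)}\|g\|$ ($+\infty$ if $\partial f(x)=\emptyset$). KL property: a proper lower semicontinuous $f$ satisfies the KL property with exponent $q>0$ on a nonempty compact set $\Omega\subseteq\mathrm{dom}\,f$ on which $f$ takes a constant value $f_*$ if there exist $r,\epsilon,\sigma_q>0$ such that $f(x)-f_*\le\sigma_q\,S_f(x)^q$ for all $x$ with $\mathrm{dist}(x,\Omega)\le r$ and $f_*<f(x)<f_*+\epsilon$. MPG-N algorithm. For $M>0$ and $x\in\mathbf{C}$, let $\Psi_M(y;x)=\|F(x)+\nabla F(x)(y-x)\|+\frac{M}{2}\|y-x\|^2$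 and $T_M(x)=\arg\min_{y\in\mathbf{C}}\Psi_M(y;x)$ (unique by strong convexity). Given $x_0\in\mathbf{C}$ and $L_0,\delta>0$, a sequence $(x_k)_{k\ge0}$ is generated by MPG-N if for each $k\ge0$ there is $M_k$ with $L_0\le M_k\le 2L_F$ such that $$\frac{\delta}{2}\|T_{M_k}(x_k)-x_k\|^2\le \Psi_{M_k}\big(T_{M_k}(x_k);x_k\big)-f\big(T_{M_k}(x_k)\big),$$ and $x_{k+1}=T_{M_k}(x_k)$. *)

(* Defs.v *)
From HB Require Import structures.
From mathcomp Require Import all_boot all_order all_algebra.
From mathcomp Require Import all_classical all_reals all_analysis.

Set Implicit Arguments.
Unset Strict Implicit.
Unset Printing Implicit Defensive.

Import Order.TTheory GRing.Theory Num.Theory.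
Import numFieldNormedType.Exports.

Local Open Scope classical_set_scope.
Local Open Scope ring_scope.

Section Euclidean.
Context {R : realType} {n : nat}.
Implicit Types (u v x : 'rV[R]_n) (A : set 'rV[R]_n).

Definition dot u v : R := \sum_(i < n) u ord0 i * v ord0 i.

(* The norm `|_| that MathComp-Analysis puts on matrices is the sup norm: it
   induces the same topology, but it is not the Euclidean norm. *)
Definition norm2 v : R := Num.sqrt (dot v v).

(* +oo when A is empty *)
Definition dist2 x A : \bar R := ereal_inf [set (norm2 (x - y))%:E | y in A].

End Euclidean.

(* A matrix with n rows and m columns acts on row vectors on the right, as the
   library's jacobian does; opnorm2 is the operator norm of this action. *)
Definition opnorm2 {R : realType} {n m : nat} (A : 'M[R]_(n, m)) : R :=
  sup [set norm2 (v *m A) | v in [set v : 'rV[R]_n | norm2 v <= 1]].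

Section Subdifferential.
Context {R : realType} {n : nat}.
Local Open Scope ereal_scope.
(* Values are meant to lie in R `|` {+oo}. *)
Variable f : 'rV[R]_n -> \bar R.

Definition domain : set 'rV[R]_n := [set x | f x < +oo].

Definition frechet_subdiff (x : 'rV[R]_n) : set 'rV[R]_n :=
  [set g | domain x /\
    0 <= limf_einf
      (fun y => (f y - f x - (dot g (y - x))%:E) / (norm2 (y - x))%:E) x^'].

Definition limiting_subdiff (x : 'rV[R]_n) : set 'rV[R]_n :=
  [set g | exists xs gs : nat -> 'rV[R]_n,
    [/\ xs @ \oo --> x,
        f (xs k) @[k --> \oo] --> f x,
        forall k, frechet_subdiff (xs k) (gs k)
      & gs @ \oo --> g]].

Definition subdiff_dist (x : 'rV[R]_n) : \bar R :=
  ereal_inf [set (norm2 g)%:E | g in limiting_subdiff x].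

Definition KL_property (q : R) (Omega : set 'rV[R]_n) (fs : R) : Prop :=
  [/\ Omega !=set0, compact Omega, Omega `<=` domain,
      forall x, Omega x -> f x = fs%:E
    & exists r eps sigma : R,
      [/\ (0 < r)%R, (0 < eps)%R, (0 < sigma)%R
        & forall x, dist2 x Omega <= r%:E ->
            fs%:E < f x -> f x < fs%:E + eps%:E ->
            f x - fs%:E <= sigma%:E * poweR (subdiff_dist x) q]].

End Subdifferential.

Section MPGN.
Context {R : realType} {n m : nat}.
Variables (C : set 'rV[R]_n) (F : 'rV[R]_n -> 'rV[R]_m).

Definition set_indicator (x : 'rV[R]_n) : \bar R :=
  if x \in C then 0%E else +oo%E.

Definition objective (x : 'rV[R]_n) : \bar R :=
  ((norm2 (F x))%:E + set_indicator x)%E.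

Definition Psi (M : R) (y x : 'rV[R]_n) : R :=
  norm2 (F x + (y - x) *m jacobian F x) + M / 2 * norm2 (y - x) ^+ 2.

(* The set of minimizers; for M > 0 and C nonempty, closed and convex, it is
   a singleton. *)
Definition T_argmin (M : R) (x : 'rV[R]_n) : set 'rV[R]_n :=
  [set y | C y /\ forall z, C z -> Psi M y x <= Psi M z x].

(* Limit points of a sequence are the cluster points of xs @ \oo, that is the
   limits of its subsequences, not the accumulation points of its range. *)
Definition limit_points (xs : nat -> 'rV[R]_n) : set 'rV[R]_n :=
  cluster (xs @ \oo).

Definition MPGN_sequence (LF L0 delta : R) (xs : nat -> 'rV[R]_n) : Prop :=
  C (xs 0%N) /\
  forall k, exists M : R,
    [/\ L0 <= M <= 2 * LF, T_argmin M (xs k) (xs k.+1)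
      & ((delta / 2 * norm2 (xs k.+1 - xs k) ^+ 2)%:E
           <= (Psi M (xs k.+1) (xs k))%:E - objective (xs k.+1))%E].

End MPGN.

(* Main.v *)
(* Minimality of x_{k+1} for the model gives the descent
     f(x_{k+1}) + delta/2 d_k^2 <= f(x_k),  where d_k = |x_{k+1} - x_k|,
   so f(x_k) decreases to f_*, d_k tends to 0, and the iterates approach their
   limit points. Let y_k minimize |F y| + 2 L_F |y - x_k|^2 over C. Then
   4 L_F (x_k - y_k) is a Frechet subgradient of f at y_k, and comparing the model
   with F by Taylor's inequality yields |y_k - x_k| <= 2 d_k and
   f(x_{k+1}) - f(y_k) <= 6 L_F d_k^2. The KL inequality at y_k then gives
     f(x_{k+1}) - f_* <= sigma (8 L_F d_k)^q + 6 L_F d_k^2 <= B d_k^min(q,2)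
   for large k, and d_k^2 <= (2/delta) (f(x_k) - f(x_{k+1})) turns this into a
   recursion for f(x_k) - f_* that has the stated rates. *)
Require Import Defs.
From HB Require Import structures.
From mathcomp Require Import all_boot all_order all_algebra.
From mathcomp Require Import all_classical all_reals all_analysis.
From mathcomp Require Import ring lra.
Import Order.TTheory GRing.Theory Num.Theory.
Import numFieldNormedType.Exports.
Local Open Scope classical_set_scope.
Local Open Scope ring_scope.

(** * The Euclidean norm and the operator norm *)

Section Norm2.
Context {R : realType} {n : nat}.
Implicit Types u v w : 'rV[R]_n.

Lemma dotC u v : dot u v = dot v u.
Proof. by apply: eq_bigr => i _; rewrite mulrC. Qed.

Lemma dotDl u v w : dot (u + v) w = dot u w + dot v w.
Proof. by rewrite /dot -big_split; apply: eq_bigr => i _ /=; rewrite mxE mulrDl. Qed.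

Lemma dotZl (a : R) u v : dot (a *: u) v = a * dot u v.
Proof. by rewrite /dot mulr_sumr; apply: eq_bigr => i _; rewrite mxE mulrA. Qed.

Lemma dotNl u v : dot (- u) v = - dot u v.
Proof. by rewrite -scaleN1r dotZl mulN1r. Qed.

Lemma dotDr u v w : dot u (v + w) = dot u v + dot u w.
Proof. by rewrite dotC dotDl !(dotC u). Qed.

Lemma dotZr (a : R) u v : dot u (a *: v) = a * dot u v.
Proof. by rewrite dotC dotZl dotC. Qed.

Lemma dotNr u v : dot u (- v) = - dot u v.
Proof. by rewrite dotC dotNl dotC. Qed.

Lemma dot_ge0 v : 0 <= dot v v.
Proof. by apply: sumr_ge0 => i _; rewrite -expr2 sqr_ge0. Qed.

Lemma norm2_ge0 v : 0 <= norm2 v.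
Proof. exact: sqrtr_ge0. Qed.

Lemma norm2_sqr v : norm2 v ^+ 2 = dot v v.
Proof. by rewrite /norm2 sqr_sqrtr ?dot_ge0. Qed.

Lemma coord_le_norm v i : `|v ord0 i| <= `|v|.
Proof.
by rewrite [leRHS]/Num.norm/= mx_normrE; exact: (le_bigmax_cond _ (j := (ord0, i))).
Qed.

(** With [norm2_le_norm], this moves limits, boundedness and compactness between [norm2] and the sup
    norm that carries the topology. *)
Lemma norm_le_norm2 v : `|v| <= norm2 v.
Proof.
rewrite [leLHS]/Num.norm/= mx_normrE; apply/bigmax_leP; split=> [|[i j] _ /=].
  exact: norm2_ge0.
rewrite (ord1 i) -sqrtr_sqr ler_sqrt ?dot_ge0// /dot (bigD1 j)//= -expr2 lerDl.
by apply: sumr_ge0 => k _; rewrite -expr2 sqr_ge0.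
Qed.

Lemma norm2_le_norm v : norm2 v <= Num.sqrt n%:R * `|v|.
Proof.
rewrite -[X in _ * X]ger0_norm// -sqrtr_sqr -sqrtrM ?ler0n// ler_sqrt; last first.
  by rewrite mulr_ge0 ?sqr_ge0 ?ler0n.
rewrite mulr_natl -[X in _ *+ X]card_ord -sumr_const; apply: ler_sum => i _.
by rewrite -expr2 -real_normK ?num_real// lerXn2r ?nnegrE// coord_le_norm.
Qed.

Lemma norm2_eq0 v : norm2 v = 0 -> v = 0.
Proof.
by move=> v0; apply/normr0_eq0/le_anti; rewrite normr_ge0 -[X in _ <= X]v0 norm_le_norm2.
Qed.

Lemma norm20 : norm2 (0 : 'rV[R]_n) = 0.
Proof. by apply/le_anti; rewrite norm2_ge0 (le_trans (norm2_le_norm _))// normr0 mulr0. Qed.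

Lemma norm2Z (a : R) v : norm2 (a *: v) = `|a| * norm2 v.
Proof.
by rewrite /norm2 dotZl dotZr mulrA -expr2 sqrtrM ?sqr_ge0// sqrtr_sqr.
Qed.

Lemma norm2N v : norm2 (- v) = norm2 v.
Proof. by rewrite -scaleN1r norm2Z normrN1 mul1r. Qed.

Lemma norm2B u v : norm2 (u - v) = norm2 (v - u).
Proof. by rewrite -norm2N opprB. Qed.

Lemma cauchy_schwarz u v : dot u v <= norm2 u * norm2 v.
Proof.
have [v0|v0] := eqVneq (norm2 v) 0.
  rewrite v0 mulr0 (norm2_eq0 v v0) -[X in dot u X](scale0r v) dotZr mul0r.
  exact: lexx.
have vgt0 : 0 < norm2 v by rewrite lt_neqAle eq_sym v0 norm2_ge0.
have [u0|u0] := eqVneq (norm2 u) 0.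
  rewrite u0 mul0r (norm2_eq0 u u0) -[X in dot X v](scale0r u) dotZl mul0r.
  exact: lexx.
have ugt0 : 0 < norm2 u by rewrite lt_neqAle eq_sym u0 norm2_ge0.
(* The square expands to 2 |u| |v| (|u| |v| - <u, v>), whose factor |u| |v| is positive here. *)
have := dot_ge0 (norm2 v *: u - norm2 u *: v).
rewrite !(dotDl, dotDr, dotNl, dotNr, dotZl, dotZr) -!norm2_sqr (dotC v u) => h.
have uv := mulr_gt0 ugt0 vgt0.
rewrite -(ler_pM2l uv); nra.
Qed.

Lemma norm2D_sqr u v :
  norm2 (u + v) ^+ 2 = norm2 u ^+ 2 + 2 * dot u v + norm2 v ^+ 2.
Proof. by rewrite !norm2_sqr dotDl !dotDr (dotC v u); ring. Qed.

Lemma norm2D u v : norm2 (u + v) <= norm2 u + norm2 v.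
Proof.
rewrite -[leRHS]ger0_norm ?addr_ge0 ?norm2_ge0// -sqrtr_sqr ler_sqrt ?sqr_ge0//.
rewrite dotDl !dotDr (dotC v u) -!norm2_sqr.
have := cauchy_schwarz u v; lra.
Qed.

Lemma norm2_le_dist u v : norm2 u - norm2 v <= norm2 (u - v).
Proof. by rewrite lerBlDr (le_trans _ (norm2D _ _))// subrK. Qed.

Lemma norm2_continuous : continuous (norm2 : 'rV[R]_n -> R).
Proof.
move=> v; apply/(@cvgrPdist_lt _ _ _ (nbhs v)) => e e0; near=> u.
(* The added 1 keeps the Lipschitz constant positive when [n] is 0. *)
have k0 : 0 < Num.sqrt n%:R + 1 :> R by rewrite ltr_wpDl// sqrtr_ge0.
have h w z : norm2 w - norm2 z <= (Num.sqrt n%:R + 1) * `|w - z|.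
  apply: (le_trans (norm2_le_dist _ _)); apply: (le_trans (norm2_le_norm _)).
  by rewrite ler_wpM2r// lerDl.
apply: (@le_lt_trans _ _ ((Num.sqrt n%:R + 1) * `|v - u|)).
  by rewrite ler_norml h andbT lerNl opprB distrC h.
rewrite mulrC -ltr_pdivlMr//; near: u.
have /(@cvgrPdist_lt _ _ _ (nbhs v)) := @cvg_id _ (nbhs v); apply; exact: divr_gt0.
Unshelve. all: by end_near. Qed.

End Norm2.

(** A real [sup] is an upper bound only of a bounded set. The sum of the row norms bounds this one,
    as the coordinates of a vector in the unit ball are at most 1 in absolute value. *)
Lemma opnorm2_le (R : realType) (n m : nat) (A : 'M[R]_(n, m)) (v : 'rV[R]_n) :
  norm2 (v *m A) <= opnorm2 A * norm2 v.
Proof.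
pose S := [set norm2 (w *m A) | w in [set w : 'rV[R]_n | norm2 w <= 1]].
have ubS : has_sup S.
  split; first by exists (norm2 (0 *m A)); exists 0 => //=; rewrite norm20 ler01.
  exists (\sum_i norm2 (row i A)) => _ [w /= w1 <-].
  rewrite mulmx_sum_row.
  have : norm2 (\sum_i w ord0 i *: row i A) <= \sum_i norm2 (w ord0 i *: row i A).
    elim/big_ind2 : _ => [|x1 x2 y1 y2 h1 h2|//]; first by rewrite norm20.
    by rewrite (le_trans (norm2D _ _))// lerD.
  move=> /le_trans; apply; apply: ler_sum => i _.
  rewrite norm2Z ler_piMl ?norm2_ge0//.
  by rewrite (le_trans (coord_le_norm _ _))// (le_trans (norm_le_norm2 _)).
have [v0|v0] := eqVneq (norm2 v) 0.
  by rewrite v0 mulr0 (norm2_eq0 v v0) mul0mx norm20.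
have vgt0 : 0 < norm2 v by rewrite lt_neqAle eq_sym v0 norm2_ge0.
rewrite -ler_pdivrMr//; apply: sup_upper_bound => //.
have vi : `|(norm2 v)^-1| = (norm2 v)^-1 by rewrite ger0_norm ?invr_ge0 ?norm2_ge0.
exists ((norm2 v)^-1 *: v) => /=; first by rewrite norm2Z vi mulVf.
by rewrite -scalemxAl norm2Z vi mulrC.
Qed.

(** * Sequences with vanishing steps *)

(* An orbit with vanishing steps that left a neighbourhood of the limit points
   infinitely often would visit an annulus around them infinitely often, and
   would therefore have a limit point there. *)
Lemma near_limit_points (R : realType) (n : nat) (xs : nat -> 'rV[R]_n) (r : R) :
  0 < r -> (forall e, 0 < e -> \forall k \near \oo, `|xs k.+1 - xs k| < e) ->
  limit_points xs !=set0 -> compact (limit_points xs) ->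
  \forall k \near \oo, exists2 w, limit_points xs w & `|xs k - w| < r.
Proof.
move=> r0 steps [w0 w0lim] cpt.
pose A s x := exists2 w, limit_points xs w & `|x - w| < s.
have Ale s t x : s <= t -> A s x -> A t x.
  by move=> st [w wl xw]; exists w => //; exact: lt_le_trans st.
have r2 : 0 < r / 2 by rewrite divr_gt0.
apply: contrapT => notnear.
have away N : exists2 k, (N <= k)%N & ~ A r (xs k).
  apply: contrapT => h; apply: notnear; exists N => // k /= Nk.
  by apply: contrapT => nA; apply: h; exists k.
have close N : exists2 k, (N <= k)%N & A (r / 2) (xs k).
  have tail : (xs @ \oo) (xs @` [set k | (N <= k)%N]).
    by exists N => // k Nk; exists k.
  have [x [[k Nk <-]]] := w0lim _ _ tail (nbhsx_ballx w0 _ r2).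
  by rewrite -ball_normE /= distrC => wx; exists k => //; exists w0.
pose P := [set j | A r (xs j) /\ ~ A (r / 2) (xs j)].
have annulus N : exists2 j, (N <= j)%N & P j.
  have [N0 _ N0P] := steps _ r2.
  have [k1 k1N A1] := close (maxn N N0).
  have [k2 k2k1 A2] := away k1.
  (* Take the first index from [k1] on that is outside the r/2-neighbourhood. It is not [k1], so its
     predecessor is inside, and a step shorter than r/2 cannot leave the r-neighbourhood. *)
  have ex : exists j, (k1 <= j)%N && `[< ~ A (r / 2) (xs j) >].
    exists k2; rewrite k2k1; apply/asboolP => Ak2; apply: A2; apply: Ale Ak2.
    by rewrite ler_pdivrMr// ler_peMr ?ltW// ltr1n.
  case: (ex_minnP ex) => -[|j] /andP[k1j /asboolP Aj] minj.
    by move: k1j; rewrite leqn0 => /eqP k10; move: A1; rewrite k10.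
  have k1j' : (k1 <= j)%N.
    rewrite leqNgt; apply/negP => jk1; apply: Aj.
    by have -> : j.+1 = k1 by apply/eqP; rewrite eqn_leq k1j jk1.
  exists j.+1; first by rewrite (leq_trans _ k1j)// (leq_trans _ k1N)// leq_maxl.
  split => //.
  have [w wl wj] : A (r / 2) (xs j).
    apply: contrapT => nA; have := minj j.
    by rewrite k1j' ltnn => /(_ (asboolT nA)).
  exists w => //; rewrite -(subrKA (xs j)) (le_lt_trans (ler_normD _ _))//.
  rewrite (splitr r) ltrD//; apply: N0P => /=.
  by rewrite (leq_trans _ k1j')// (leq_trans _ k1N)// leq_maxr.
(* The subsequence of iterates in the annulus, as a filter; it is proper because [P] is infinite. *)
pose G := xs @ within P \oo.
have FG : ProperFilter G.
  apply: Build_ProperFilter => -[N _ NP].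
  by have [j Nj Pj] := annulus N; exact: NP Nj Pj.
have [M MO] : exists M : R, forall w, limit_points xs w -> `|w| <= M.
  have [M [Mr MP]] := compact_bounded cpt.
  by exists (M + 1) => w; apply: MP; rewrite ltrDl.
pose K := [set x : 'rV[R]_n | `|x| <= M + r].
have cptK : compact K.
  apply: bounded_closed_compact.
    by exists (M + r); split; [exact: num_real|move=> z zM x /le_trans; apply; exact: ltW].
  apply: (@preimage_closed _ _ (fun x : 'rV[R]_n => `|x|) [set y : R | y <= M + r]).
    by move=> x _; exact: norm_continuous.
  exact: closed_le.
have GK : G K.
  exists 0%N => // j _ [[w wl wj] _].
  rewrite /K /= -(subrK w (xs j)) (le_trans (ler_normD _ _))// addrC.
  by rewrite lerD ?MO// ltW.
have [p [_ pG]] := cptK G FG GK.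
have pO : limit_points xs p.
  apply: cvg_cluster pG => U [N _ NU]; exists N => // j Nj _; exact: NU.
(* Near the limit point [p] there is an iterate indexed by [P], yet such an iterate is at least r/2
   away from every limit point. *)
have GP : G (xs @` P) by exists 0%N => // j _ Pj; exists j.
have [x [[j [_ nA] <-]]] := pG _ _ GP (nbhsx_ballx p _ r2).
by rewrite -ball_normE /= distrC => xp; apply: nA; exists p.
Qed.

(** * Sublinear rate from a real recursion *)

(* If a k.+1 exceeded the bound, then by the recursion so would a k, because
   (1 + 1/k)^b <= 1 + 2 b e^b / (k + 1) for b = q / (2 - q). *)
Lemma powR_rate (R : realType) (a : nat -> R) (D q : R) (N : nat) :
  0 < D -> 0 < q -> q < 2 -> (forall k, 0 <= a k) ->
  (forall k, (N <= k)%N -> a k.+1 <= a k) ->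
  (forall k, (N <= k)%N -> a k.+1 <= D * (a k - a k.+1) `^ (q / 2)) ->
  exists c : R, 0 < c /\
    forall k, (maxn N 1 <= k)%N -> a k <= c * k%:R `^ (- (q / (2 - q))).
Proof.
move=> D0 q0 q2 a0 decr rec.
have pD (x y z : R) : 0 < x -> x `^ (y + z) = x `^ y * x `^ z.
  by move=> x0; apply: powRD; rewrite (gt_eqF x0) implybT.
set b := q / (2 - q).
have b0 : 0 < b by rewrite divr_gt0// subr_gt0.
(* The rate k^(-b) has increments of order k^(-(b+1)); this identity says that the recursion turns
   them back into k^(-b). *)
have bp : (b + 1) * (q / 2) = b.
  by rewrite /b; field; lra.
pose K := 2 * b * expR b.
have K0 : 0 < K by rewrite /K; have := expR_gt0 b; nra.
pose N1 := maxn N 1.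
pose c0 := D `^ (2 / (2 - q)) * K `^ b.
have c00 : 0 < c0 by rewrite mulr_gt0// powR_gt0.
(* The second summand starts the induction at [N1]; the first serves the inductive step. *)
pose c := c0 + a N1 * N1%:R `^ b.
have c0c : c0 <= c by rewrite lerDl mulr_ge0// powR_ge0.
have cgt0 : 0 < c by exact: lt_le_trans c0c.
exists c; split=> // k /subnK <-.
elim: (k - N1)%N => {k} [|j].
  rewrite add0n powRN ler_pdivlMr; last by rewrite powR_gt0// ltr0n leq_max orbT.
  by rewrite lerDr ltW.
rewrite addSn; set k := (j + _)%N => IH.
have kN : (N <= k)%N by rewrite (leq_trans (leq_maxl N 1))// leq_addl.
have k1 : (0 < k)%N by rewrite (leq_trans (leq_maxr N 1))// leq_addl.
have kR : 1 <= k%:R :> R by rewrite ler1n.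
have kR0 : 0 < k%:R :> R by rewrite ltr0n.
have k1R0 : 0 < k.+1%:R :> R by rewrite ltr0n.
rewrite leNgt; apply/negP => lt1.
set s := k.+1%:R `^ (- b) in lt1.
have s0 : 0 < s by rewrite powR_gt0.
(* By [IH] and [lt1], the gap is less than c (k^(-b) - (k+1)^(-b)). *)
have gap : a k - a k.+1 < c * s * (K / k.+1%:R).
  have : k%:R `^ (- b) <= s * (1 + K / k.+1%:R).
    have -> : k%:R `^ (- b) = s * (1 + k%:R^-1) `^ b.
      have -> : 1 + k%:R^-1 = k.+1%:R / k%:R :> R.
        by rewrite -natr1; field; rewrite gt_eqF.
      rewrite powRM ?ler0n ?invr_ge0// mulrA /s -pD// addNr powRr0 mul1r.
      by rewrite -powR_inv1 ?ler0n// -powRrM mulN1r.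
    rewrite ler_pM2l//.
    have -> : (1 + k%:R^-1 : R) `^ b = expR (b * ln (1 + k%:R^-1)).
      by rewrite /powR gt_eqF// ltr_wpDr// invr_ge0 ler0n.
    apply: (@le_trans _ _ (expR (b / k%:R))).
      rewrite ler_expR ler_pM2l//.
      have := @le_ln1Dx R k%:R^-1; apply.
      by rewrite (lt_le_trans (ltrN10 _))// invr_ge0 ler0n.
    set x := b / k%:R.
    have x0 : 0 <= x by rewrite divr_ge0// ltW.
    (* This is 1 - x <= e^(-x) multiplied by e^x. *)
    have ex : expR x <= 1 + x * expR x.
      have := expR_ge1Dx (- x); rewrite expRN => h.
      rewrite -lerBlDr -{1}(mul1r (expR x)) -mulrBl.
      rewrite (le_trans (ler_wpM2r (ltW (expR_gt0 x)) h))// mulVf//.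
      by rewrite gt_eqF ?expR_gt0.
    apply: (le_trans ex); rewrite lerD2l.
    apply: (@le_trans _ _ (x * expR b)).
      by rewrite ler_wpM2l// ler_expR /x ler_pdivrMr// ler_peMr// ltW.
    have be0 : 0 < b * expR b by rewrite mulr_gt0// expR_gt0.
    have -> : x * expR b = b * expR b * k%:R^-1 by rewrite /x; ring.
    (* The factor 2 in [K] pays for 1/k <= 2/(k+1), valid since k >= 1. *)
    have -> : K / k.+1%:R = b * expR b * (2 / k.+1%:R) by rewrite /K; ring.
    rewrite ler_pM2l// ler_pdivlMr// mulrC ler_pdivrMr//.
    by rewrite mulr_natl mulr2n -[k.+1]addn1 (natrD _ k 1) lerD2l.
  rewrite -(ler_pM2l cgt0) => h.
  rewrite ltrBlDr (le_lt_trans (le_trans IH h))//.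
  by rewrite !mulrDr !mulr1 !mulrA addrC ltrD2l.
have gap0 : 0 <= a k - a k.+1 by rewrite subr_ge0 decr.
have : c * s < D * (c * s * (K / k.+1%:R)) `^ (q / 2).
  apply: (lt_le_trans lt1); apply: (le_trans (rec k kN)).
  rewrite ler_pM2l//; apply: ge0_ler_powR; rewrite ?nnegrE//.
  - by rewrite divr_ge0// ltW.
  - by apply: mulr_ge0; [apply: mulr_ge0|apply: divr_ge0]; rewrite ?ler0n// ltW.
  - exact: ltW.
apply/negP; rewrite -leNgt.
have -> : c * s * (K / k.+1%:R) = c * K * k.+1%:R `^ (- (b + 1)).
  rewrite opprD pD// powR_inv1 ?ler0n// -/s; ring.
have cK0 : 0 <= c * K by rewrite mulr_ge0// ltW.
rewrite powRM ?powR_ge0// -powRrM mulNr bp -/s mulrA ler_pM2r//.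
(* It remains to see c^(1 - q/2) >= D K^(q/2), which dictates c0. *)
rewrite powRM ?(ltW cgt0)// ?(ltW K0)//.
have q2' : 0 < (2 - q) / 2 by lra.
have cE : c = c `^ (q / 2) * c `^ ((2 - q) / 2).
  rewrite -pD//.
  by rewrite -[LHS]powRr1 ?ltW//; congr (_ `^ _); field.
rewrite [leRHS]cE mulrCA ler_pM2l ?powR_gt0//.
apply: (@le_trans _ _ (c0 `^ ((2 - q) / 2))); last first.
  by apply: ge0_ler_powR; rewrite ?nnegrE// ltW.
rewrite /c0 powRM ?powR_ge0// -!powRrM.
have -> : 2 / (2 - q) * ((2 - q) / 2) = 1 by field; lra.
have -> : b * ((2 - q) / 2) = q / 2 by rewrite /b; field; lra.
by rewrite powRr1 ?(ltW D0)// lexx.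
Qed.

(** * Taylor's inequality on a convex set *)

Lemma dot_continuous (R : realType) (n : nat) (w : 'rV[R]_n) :
  continuous (fun u : 'rV[R]_n => dot u w).
Proof.
apply: continuous_big => [|i _ u]; first exact: add_continuous.
apply: (@cvgMr_tmp _ _ (nbhs u) _ (fun u => u ord0 i)).
exact: coord_continuous.
Qed.

Lemma convex_set_segment (R : realType) (n : nat) (C : set 'rV[R]_n) x z (t : R) :
  convex_set C -> C x -> C z -> 0 <= t <= 1 -> C (x + t *: (z - x)).
Proof.
move=> cC Cx Cz /andP[t0 t1].
have := cC z x (Itv01 t0 t1).
rewrite !inE => /(_ Cz Cx); congr C.
by rewrite /conv /= /unstable.onem scalerBr scalerBl scale1r addrCA addrA.
Qed.

Lemma is_derive_dot_line (R : realType) (n m : nat) (F : 'rV[R]_n -> 'rV[R]_m)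
    (x v : 'rV[R]_n) (w : 'rV[R]_m) (t : R) :
  differentiable F (x + t *: v) ->
  is_derive t 1 (fun s => dot (F (x + s *: v)) w)
    (dot (v *m jacobian F (x + t *: v)) w).
Proof.
move=> dF; rewrite -deriveEjacobian//.
have cF : derivable F (x + t *: v) v by exact: diff_derivable.
have cvF : h^-1 *: (dot (F (x + (h *: 1 + t) *: v)) w - dot (F (x + t *: v)) w)
   @[h --> 0^'] --> dot ('D_v F (x + t *: v)) w.
  have := continuous_cvg _ (@dot_continuous R m w ('D_v F (x + t *: v))) cF.
  move=> /(_ _) lim; apply: cvg_trans lim; apply: near_eq_cvg; apply: nearW => h /=.
  rewrite dotZl dotDl dotNl; congr (_ * (dot (F _) _ - _)).
  by rewrite scalerDl -scalerA scale1r addrCA.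
split; first by apply/cvg_ex; eexists; exact: cvF.
exact: cvg_lim cvF.
Qed.

(** Testing against the error [w] itself reduces the claim to one real variable. The Lipschitz bound
    along the segment, which stays in [C], makes [h] nonincreasing on [0, 1], and h 1 <= h 0 reads
    |w|^2 <= L/2 |v|^2 |w|. *)
Lemma taylor1_norm2_le (R : realType) (n m : nat) (C : set 'rV[R]_n)
    (F : 'rV[R]_n -> 'rV[R]_m) (L : R) (x z : 'rV[R]_n) :
  0 <= L -> convex_set C -> (forall x, differentiable F x) ->
  (forall x y, C x -> C y ->
     opnorm2 (jacobian F x - jacobian F y) <= L * norm2 (x - y)) ->
  C x -> C z ->
  norm2 (F z - (F x + (z - x) *m jacobian F x)) <= L / 2 * norm2 (z - x) ^+ 2.
Proof.
move=> L0 cC dF lip Cx Cz; set v := z - x; set w := F z - _.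
pose a := dot (v *m jacobian F x) w.
pose b := L * norm2 v ^+ 2 * norm2 w.
pose h t : R := dot (F (x + t *: v)) w - (t * a + b / 2 * t ^+ 2).
have dh (t : R) : is_derive t 1 h (dot (v *m jacobian F (x + t *: v)) w - (a + b * t)).
  have Fd := @is_derive_dot_line R n m F x v w t (dF _).
  have Pd : is_derive t 1 (fun t : R => t * a + b / 2 * t ^+ 2) (a + b * t).
    pose p : R -> R := a \*: (@id R) + (b / 2) \*: ((@id R) ^+ 2).
    have -> : (fun t : R => t * a + b / 2 * t ^+ 2) = p.
      by apply/funext => s; rewrite /p /= mulrC.
    apply: is_derive_eq.
    by rewrite [LHS](_ : _ = a * 1 + b / 2 * (2 * t ^+ 1 * 1))//; field.
  exact: is_deriveB Fd Pd.
have dh0 (t : R) : 0 <= t -> t <= 1 -> derive1 h t <= 0.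
  move=> t0 t1; rewrite derive1E (@derive_val _ _ _ _ _ _ _ (dh t)).
  have Ct : C (x + t *: v) by apply: convex_set_segment => //; rewrite t0.
  rewrite opprD addrA -dotNl -dotDl -mulmxN -mulmxDr subr_le0.
  apply: (le_trans (cauchy_schwarz _ _)).
  have -> : b * t = L * (t * norm2 v) * norm2 v * norm2 w by rewrite /b; ring.
  rewrite ler_wpM2r ?norm2_ge0//; apply: (le_trans (opnorm2_le _ _ _ _ _)).
  rewrite ler_wpM2r ?norm2_ge0//; apply: (le_trans (lip _ _ Ct Cx)).
  by rewrite addrAC subrr add0r norm2Z ger0_norm.
have : h 1 <= h 0.
  apply: (@ler0_derive1_le_cc _ h 0 1) => //.
  - by move=> t; rewrite in_itv/= => /andP[t0 t1]; apply: dh0; exact: ltW.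
  - apply: continuous_subspaceT => t; apply/differentiable_continuous.
    by apply/derivable1_diffP; have [] := dh t.
  - by rewrite in_itv/= lexx ler01.
  - by rewrite in_itv/= lexx ler01.
rewrite /h scale1r scale0r addr0 subrKC => h10.
have ww : norm2 w ^+ 2 <= b / 2.
  rewrite norm2_sqr {1}/w dotDl dotNl dotDl -/a; lra.
have [w0|w0] := eqVneq (norm2 w) 0.
  by rewrite w0 mulr_ge0 ?sqr_ge0 ?divr_ge0.
have wgt0 : 0 < norm2 w by rewrite lt_neqAle eq_sym w0 norm2_ge0.
rewrite -(ler_pM2r wgt0) -expr2 (le_trans ww)// /b; lra.
Qed.

(** * Proximal points and subgradients *)

Lemma norm2B_continuous (R : realType) (n : nat) (x : 'rV[R]_n) :
  continuous (fun y : 'rV[R]_n => norm2 (y - x)).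
Proof.
move=> y; have shift : (fun u : 'rV[R]_n => u - x) @ nbhs y --> nbhs (y - x).
  by apply: (@cvgB _ _ _ (nbhs y)); [exact: cvg_id|exact: cvg_cst].
exact: cvg_comp shift (norm2_continuous (y - x)).
Qed.

(** Since [phi] is nonnegative, the quadratic term bounds the sublevel set of [psi] through [x],
    which is therefore compact; a minimizer there is global on [C]. *)
Lemma prox_point_exists (R : realType) (n : nat) (C : set 'rV[R]_n)
    (phi : 'rV[R]_n -> R) (mu : R) (x : 'rV[R]_n) :
  closed C -> C x -> continuous phi -> (forall y, 0 <= phi y) -> 0 < mu ->
  exists2 y, C y & forall z, C z ->
    phi y + mu * norm2 (y - x) ^+ 2 <= phi z + mu * norm2 (z - x) ^+ 2.
Proof.
move=> cC Cx cphi phi0 mu0.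
pose psi y : R := phi y + mu * norm2 (y - x) ^+ 2.
have cn := norm2B_continuous R n x.
have cpsi : continuous psi.
  move=> y; apply: (@cvgD _ _ _ (nbhs y)); first exact: cphi.
  apply: (@cvgMl_tmp _ _ (nbhs y)).
  exact: (@cvgM _ _ (nbhs y) _ _ _ _ _ (cn y) (cn y)).
pose K := C `&` [set y | psi y <= psi x].
have cptK : compact K.
  apply: bounded_closed_compact; last first.
    apply: closedI => //; apply: (@preimage_closed _ _ psi [set t : R | t <= psi x]).
      by move=> y _; exact: cpsi.
    exact: closed_le.
  (* From t^2 <= s follows t <= s + 1, which avoids a square root. *)
  exists (`|x| + (psi x / mu + 1)); split; first exact: num_real.
  move=> B /ltW xB y [_ /= yx]; apply: le_trans xB.
  rewrite -(subrKC x y) (le_trans (ler_normD _ _))// lerD2l.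
  apply: (le_trans (norm_le_norm2 _)).
  have : mu * norm2 (y - x) ^+ 2 <= psi x.
    by apply: le_trans yx; rewrite /psi lerDr.
  rewrite mulrC -ler_pdivlMr//; have := norm2_ge0 (y - x); nra.
have K0 : K !=set0 by exists x; split => //=.
have [y] := compact_EVT_min K0 cptK (continuous_subspaceT cpsi).
rewrite inE => -[Cy yx] ymin; exists y => // z Cz.
have [zx|xz] := leP (psi z) (psi x); first by apply: ymin; rewrite inE; split.
exact: le_trans (le_trans yx (ltW xz)).
Qed.

Lemma objectiveE (R : realType) (n m : nat) (C : set 'rV[R]_n)
    (F : 'rV[R]_n -> 'rV[R]_m) (x : 'rV[R]_n) :
  C x -> objective C F x = (norm2 (F x))%:E.
Proof. by move=> Cx; rewrite /objective /set_indicator mem_set// adde0. Qed.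

(** For z in [C], minimality gives f(z) - f(y) >= mu (|y - x|^2 - |z - x|^2) = <2 mu (x - y), z - y>
    - mu |z - y|^2, so the difference quotient is at least - mu |z - y|, which tends to 0. For z
    outside [C] the quotient is +oo. *)
Lemma frechet_subdiff_prox_point (R : realType) (n m : nat) (C : set 'rV[R]_n)
    (F : 'rV[R]_n -> 'rV[R]_m) (mu : R) (x y : 'rV[R]_n) :
  0 < mu -> C y ->
  (forall z, C z -> norm2 (F y) + mu * norm2 (y - x) ^+ 2
                    <= norm2 (F z) + mu * norm2 (z - x) ^+ 2) ->
  frechet_subdiff (objective C F) y ((2 * mu) *: (x - y)).
Proof.
move=> mu0 Cy ymin; split; first by rewrite /domain /= objectiveE// ltry.
rewrite limf_einfE; apply/lee_addgt0Pr => e e0.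
pose V : set 'rV[R]_n := [set z | z != y /\ mu * norm2 (z - y) < e].
have nV : y^' V.
  have : norm2 (u - y) @[u --> nbhs y] --> norm2 (y - y).
    exact: norm2B_continuous.
  rewrite subrr norm20 => /(@cvgr_lt _ _ (nbhs y)) /(_ (e / mu)).
  rewrite divr_gt0// => /(_ isT) cl; apply: filterS cl => z /= ze zy.
  by split=> //; rewrite mulrC -ltr_pdivlMr.
rewrite -leeBlDr// sub0e; apply: le_ereal_sup_tmp; eexists; first by exists V.
apply: le_ereal_inf_tmp => _ [z [zy ze] <-].
have nz : 0 < norm2 (z - y).
  rewrite lt_neqAle norm2_ge0 andbT eq_sym; apply: contra_neq zy => /norm2_eq0.
  by move/eqP; rewrite subr_eq0 => /eqP.
rewrite (objectiveE _ _ _ _ _ _ Cy) inver gt_eqF//.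
have [Cz|nCz] := pselect (C z); last first.
  rewrite /objective /set_indicator memNset// addey// addye//.
  by rewrite gt0_mulye ?lte_fin ?invr_gt0// leey.
rewrite objectiveE// -!EFinB -EFinM -EFinN lee_fin ler_pdivlMr//.
rewrite mulNr; apply: (@le_trans _ _ (- (mu * norm2 (z - y) * norm2 (z - y)))).
  by rewrite lerN2 ler_wpM2r ?ltW.
have := ymin z Cz.
have -> : z - x = (z - y) + (y - x) by rewrite subrKA.
have -> : x - y = - (y - x) by rewrite opprB.
rewrite (norm2D_sqr (z - y)) dotZl dotNl (dotC (y - x)); nra.
Qed.
Lemma subdiff_dist_le (R : realType) (n : nat) (f : 'rV[R]_n -> \bar R)
    (x g : 'rV[R]_n) :
  frechet_subdiff f x g -> (subdiff_dist f x <= (norm2 g)%:E)%E.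
Proof.
move=> fg; apply: ereal_inf_lbound; exists g => //.
by exists (fun=> x), (fun=> g); split => //; exact: cvg_cst.
Qed.

(** * The MPG-N iterates *)

Section Rates.
Context {R : realType} {n m : nat}.
Variables (C : set 'rV[R]_n) (F : 'rV[R]_n -> 'rV[R]_m) (LF L0 delta : R).
Hypotheses (C_closed : closed C) (C_convex : convex_set C).
Hypothesis F_diff : forall x, differentiable F x.
Hypotheses (LF_gt0 : 0 < LF) (delta_gt0 : 0 < delta).
Hypothesis F_lip : forall x y, C x -> C y ->
  opnorm2 (jacobian F x - jacobian F y) <= LF * norm2 (x - y).

Lemma norm2_comp_continuous : continuous (fun x => norm2 (F x)).
Proof.
move=> x; have Fx : F @ nbhs x --> nbhs (F x).
  exact: differentiable_continuous.
exact: cvg_comp Fx (norm2_continuous (F x)).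
Qed.

(* The subgradient is not taken at the new iterate but at a proximal point y of
   f: the model Psi may vanish at its minimizer, which would make the
   subgradients of f and of Psi there unrelated. *)
Lemma MPGN_step_prox_point (M : R) (x x' : 'rV[R]_n) :
  C x -> M <= 2 * LF -> T_argmin C F M x x' ->
  ((delta / 2 * norm2 (x' - x) ^+ 2)%:E
     <= (Psi F M x' x)%:E - objective C F x')%E ->
  exists y, [/\ C y, norm2 (F y) <= norm2 (F x), norm2 (y - x) <= 2 * norm2 (x' - x),
    norm2 (F x') - norm2 (F y) <= 6 * LF * norm2 (x' - x) ^+ 2
    & frechet_subdiff (objective C F) y ((4 * LF) *: (x - y))].
Proof.
move=> Cx M2 [Cx' x'min]; rewrite objectiveE// -EFinB lee_fin => desc.
have mu0 : 0 < 2 * LF by rewrite mulr_gt0.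
have [y Cy ymin] := prox_point_exists _ _ _ _ _ _ C_closed Cx
  norm2_comp_continuous (fun x => norm2_ge0 (F x)) mu0.
have yx := ymin _ Cx; have yx' := ymin _ Cx'; exists y.
(* Taylor's error contributes L_F/2 and the regularization M/2 <= L_F. *)
have psi_y : Psi F M y x <= norm2 (F y) + 3 / 2 * LF * norm2 (y - x) ^+ 2.
  have := taylor1_norm2_le _ _ _ _ _ _ _ _ (ltW LF_gt0) C_convex F_diff F_lip Cx Cy.
  have := norm2_le_dist (F x + (y - x) *m jacobian F x) (F y).
  rewrite norm2B /Psi; have := sqr_ge0 (norm2 (y - x)); nra.
have x'y := x'min _ Cy.
have d2 := sqr_ge0 (norm2 (x' - x)).
have dd2 : 0 <= delta / 2 * norm2 (x' - x) ^+ 2 by rewrite mulr_ge0// divr_ge0 ?ltW.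
(* The proximal weight 2 L_F exceeds the 3/2 L_F of [psi_y]. Adding [desc], [x'y], [psi_y] and [yx']
   leaves L_F/2 |y - x|^2 <= 2 L_F |x' - x|^2. *)
have yx2 : norm2 (y - x) ^+ 2 <= 4 * norm2 (x' - x) ^+ 2.
  rewrite -(ler_pM2l LF_gt0); lra.
split=> //.
- move: yx; rewrite subrr norm20 expr0n/= mulr0 addr0; apply: le_trans.
  by rewrite lerDl mulr_ge0 ?sqr_ge0// ltW.
- rewrite -(@ler_pXn2r _ 2)// ?nnegrE ?mulr_ge0 ?norm2_ge0// exprMn.
  by rewrite (le_trans yx2)// ler_wpM2r// expr2; lra.
- move: yx2; rewrite -(ler_pM2l LF_gt0) => yx2; lra.
- rewrite (_ : 4 * LF = 2 * (2 * LF)); last by ring.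
  exact: frechet_subdiff_prox_point.
Qed.

Variable xs : nat -> 'rV[R]_n.
Hypothesis xs_MPGN : MPGN_sequence C F LF L0 delta xs.

Let a k := norm2 (F (xs k)).
Let d k := norm2 (xs k.+1 - xs k).

Lemma MPGN_mem k : C (xs k).
Proof.
by case: k => [|k]; [case: xs_MPGN|have [M [_ []]] := xs_MPGN.2 k].
Qed.

(** The model centred at x_k takes the value |F x_k| at x_k, so its minimum over [C] is no
    larger. *)
Lemma MPGN_descent k : a k.+1 + delta / 2 * d k ^+ 2 <= a k.
Proof.
have [M [_ [Cx' x'min]]] := xs_MPGN.2 k.
rewrite objectiveE// -EFinB lee_fin => desc.
have := x'min _ (MPGN_mem k).
rewrite {2}/Psi subrr mul0mx addr0 norm20 expr0n/= mulr0 addr0 -/(a k) => psia.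
by rewrite addrC -lerBrDr (le_trans desc)// lerB.
Qed.

Lemma MPGN_nonincreasing : nonincreasing_seq a.
Proof.
apply/nonincreasing_seqP => k; apply: le_trans (MPGN_descent k).
by rewrite lerDl mulr_ge0 ?sqr_ge0// divr_ge0 ?ltW.
Qed.

Variables (q fs : R).
Hypotheses (q_gt0 : 0 < q).
Hypothesis f_KL : KL_property (objective C F) q (limit_points xs) fs.

(** Monotonicity and the lower bound 0 give a limit. By continuity of |F| at a limit point [w], the
    values also cluster at |F w| = [fs], which identifies it. *)
Lemma MPGN_cvg : a @ \oo --> fs.
Proof.
have [[w w_lim] _ sub_dom f_fs _] := f_KL.
have Cw : C w.
  apply: contrapT => nC; have := sub_dom _ w_lim.
  by rewrite /domain/= /objective /set_indicator memNset// addey.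
have := f_fs _ w_lim; rewrite objectiveE// => -[Fw].
have : cvgn a.
  apply: nonincreasing_is_cvgn; first exact: MPGN_nonincreasing.
  by exists 0 => _ [k _ <-]; exact: norm2_ge0.
set l := limn a => al; suff <- : l = fs by [].
apply/eqP; rewrite -subr_eq0 -normr_le0; apply/ler_addgt0Pr => e e0.
have e2 : 0 < e / 2 by rewrite divr_gt0.
have near_l : (xs @ \oo) (xs @` [set k | `|l - a k| < e / 2]).
  have /cvgrPdist_lt/(_ _ e2) := al.
  by apply: filterS => k /= kl; exists k.
have near_w : nbhs w [set x | `|fs - norm2 (F x)| < e / 2].
  have : norm2 (F x) @[x --> nbhs w] --> norm2 (F w) by exact: norm2_comp_continuous.
  by rewrite Fw => /(@cvgrPdist_lt _ _ _ (nbhs w)); apply.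
have [x [[k /= kl <-] kw]] := w_lim _ _ near_l near_w.
rewrite add0r -(subrKA (a k)) (le_trans (ler_normD _ _))//.
by rewrite (splitr e) lerD// ltW// distrC.
Qed.

Lemma MPGN_ge k : fs <= a k.
Proof.
have <- := cvg_lim (@Rhausdorff R) MPGN_cvg.
by apply: nonincreasing_cvgn_ge; [exact: MPGN_nonincreasing|exact: cvgP MPGN_cvg].
Qed.

Lemma MPGN_step_sqr k : d k ^+ 2 <= 2 / delta * (a k - a k.+1).
Proof.
rewrite mulrAC ler_pdivlMr//; have := MPGN_descent k; lra.
Qed.

Lemma MPGN_step_cvg0 e : 0 < e -> \forall k \near \oo, d k < e.
Proof.
move=> e0; have e1 : 0 < delta / 2 * e ^+ 2 by rewrite mulr_gt0 ?exprn_gt0 ?divr_gt0.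
have /cvgrPdist_lt/(_ _ e1) := MPGN_cvg; apply: filterS => k /= ke.
rewrite -(@ltr_pXn2r _ 2)// ?nnegrE ?norm2_ge0 ?ltW//.
have d2 : 0 < delta / 2 by rewrite divr_gt0.
rewrite -(ltr_pM2l d2); apply: le_lt_trans ke.
rewrite distrC ger0_norm ?subr_ge0 ?MPGN_ge//.
have := MPGN_descent k; have := MPGN_ge k.+1; lra.
Qed.

Lemma MPGN_near_limit_points r : 0 < r -> \forall k \near \oo,
  exists2 w, limit_points xs w & norm2 (xs k - w) < r.
Proof.
move=> r0; have s0 : 0 < Num.sqrt n%:R + 1 :> R by rewrite ltr_wpDl// sqrtr_ge0.
have [w_lim cpt _ _ _] := f_KL.
(* The radius is shrunk to pass from the sup norm to [norm2]. *)
have : \forall k \near \oo, exists2 w, limit_points xs w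
    & `|xs k - w| < r / (Num.sqrt n%:R + 1).
  apply: near_limit_points => //; first by rewrite divr_gt0.
  move=> e /MPGN_step_cvg0; apply: filterS => k; apply: le_lt_trans.
  exact: norm_le_norm2.
apply: filterS => k [w wl kw]; exists w => //.
move: kw; rewrite ltr_pdivlMr// mulrC; apply: le_lt_trans.
by rewrite (le_trans (norm2_le_norm _))// ler_wpM2r// lerDl.
Qed.

Lemma MPGN_recursion : exists D : R, exists N : nat, 0 < D /\
  forall k, (N <= k)%N ->
    a k.+1 - fs <= D * (a k - a k.+1) `^ (Num.min q 2 / 2).
Proof.
have [_ _ _ _ [r [eps [sigma [r0 eps0 sigma0 KL]]]]] := f_KL.
have r2 : 0 < r / 2 by rewrite divr_gt0.
have r4 : 0 < r / 4 by rewrite divr_gt0.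
set p := Num.min q 2.
have p0 : 0 < p by rewrite lt_min q_gt0/=.
pose B := sigma * (8 * LF) `^ q + 6 * LF.
have B0 : 0 < B.
  by rewrite addr_gt0 ?mulr_gt0// powR_gt0// mulr_gt0.
exists (B * (2 / delta) `^ (p / 2)).
(* The bound 1 serves to compare powers of d_k; r/4 and r/2 put the proximal point within 2 r/4 +
   r/2 = r of [w]; the bound on a_k keeps its value below fs + eps. *)
have [N _ NP] : \forall k \near \oo, [/\ d k < 1, d k < r / 4, a k < fs + eps
    & exists2 w, limit_points xs w & norm2 (xs k - w) < r / 2].
  near=> k; split; last by near: k; exact: MPGN_near_limit_points.
  - by near: k; exact: MPGN_step_cvg0.
  - by near: k; exact: MPGN_step_cvg0.
  - by near: k; apply: cvgr_lt MPGN_cvg _ _; rewrite ltrDl.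
exists N; split; first by rewrite mulr_gt0// powR_gt0// divr_gt0.
move=> k /NP [d1 d4 ak [w wl kw]].
have d0 : 0 <= d k by exact: norm2_ge0.
have [M [/andP[_ M2] Tx' desc]] := xs_MPGN.2 k.
have [y [Cy yx dy x'y sub]] := MPGN_step_prox_point _ _ _ (MPGN_mem k) M2 Tx' desc.
have main : a k.+1 - fs <= sigma * (8 * LF * d k) `^ q + 6 * LF * d k ^+ 2.
  (* If f(y) <= fs, the KL inequality says nothing at y, but the quadratic term alone suffices. *)
  have [yfs|fsy] := leP (norm2 (F y)) fs.
    have : 0 <= sigma * (8 * LF * d k) `^ q by rewrite mulr_ge0 ?powR_ge0// ltW.
    move: x'y; rewrite -/(a k.+1) -/(d k); lra.
  have yw : (dist2 y (limit_points xs) <= r%:E)%E.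
    apply: (@le_trans _ _ (norm2 (y - w))%:E).
      by apply: ereal_inf_lbound; exists w.
    rewrite lee_fin -(subrKA (xs k)) (le_trans (norm2D _ _))//.
    move: dy; rewrite -/(d k); lra.
  have := KL y yw; rewrite objectiveE// -EFinD !lte_fin => /(_ fsy (le_lt_trans yx ak)).
  have : (poweR (subdiff_dist (objective C F) y) q <= ((8 * LF * d k) `^ q)%:E)%E.
    rewrite -poweR_EFin; apply: gt0_ler_poweR; first exact: ltW.
    - rewrite in_itv/= leey andbT; apply: le_ereal_inf_tmp => _ [g _ <-].
      by rewrite lee_fin norm2_ge0.
    - by rewrite in_itv/= leey andbT lee_fin !mulr_ge0// ltW.
    apply: (le_trans (subdiff_dist_le _ _ _ _ _ sub)); rewrite lee_fin norm2Z.
    rewrite ger0_norm ?mulr_ge0 ?(ltW LF_gt0)// norm2B.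
    have -> : 8 * LF * d k = 4 * LF * (2 * d k) by ring.
    by rewrite ler_pM2l// mulr_gt0.
  move=> S_le f_le; have := le_trans f_le (lee_wpmul2l _ S_le).
  rewrite lee_fin => /(_ (ltW sigma0)); rewrite -EFinB -EFinM lee_fin.
  move: x'y; rewrite -/(a k.+1) -/(d k); lra.
(* As d_k < 1, the smaller exponent gives the larger power; for d_k = 0 both powers are 0, the
   exponents being positive. *)
have dp s : p <= s -> d k `^ s <= d k `^ p.
  have [->|dn0] := eqVneq (d k) 0.
    by move=> ps; rewrite !powR0// gt_eqF// (lt_le_trans p0).
  by move=> ps; apply: ger_powR => //; rewrite lt_neqAle eq_sym dn0 d0 ltW.
apply: (@le_trans _ _ (B * d k `^ p)).
  apply: (le_trans main); rewrite /B [leRHS]mulrDl lerD//.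
    rewrite -[leRHS]mulrA ler_pM2l// powRM ?mulr_ge0 ?(ltW LF_gt0)//.
    by rewrite ler_pM2l ?powR_gt0 ?mulr_gt0// dp// ge_min lexx.
  rewrite ler_pM2l ?mulr_gt0// -powR_mulrn// dp// ge_min lexx orbT//.
rewrite -mulrA ler_pM2l//.
have -> : d k `^ p = (d k ^+ 2) `^ (p / 2).
  by rewrite -powR_mulrn// -powRrM; congr (_ `^ _); field.
rewrite -powRM; last 2 first.
- by rewrite divr_ge0// ltW.
- by rewrite subr_ge0 MPGN_nonincreasing.
have dk := MPGN_step_sqr k.
apply: ge0_ler_powR; rewrite ?nnegrE ?sqr_ge0//.
- by rewrite divr_ge0// ltW.
- by apply: le_trans dk; exact: sqr_ge0.
Unshelve. all: by end_near. Qed.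

End Rates.

Theorem theorem2 (R : realType) (n m : nat)
    (C : set 'rV[R]_n) (F : 'rV[R]_n -> 'rV[R]_m) (LF : R)
    (C_neq0 : C !=set0) (C_closed : closed C) (C_convex : convex_set C)
    (F_diff : forall x, differentiable F x)
    (LF_gt0 : 0 < LF)
    (F_lip : forall x y, C x -> C y ->
      opnorm2 (jacobian F x - jacobian F y) <= LF * norm2 (x - y))
    (xstar : 'rV[R]_n) (xstar_C : C xstar)
    (xstar_min : forall x, (objective C F xstar <= objective C F x)%E)
    (L0 delta : R) (L0_gt0 : 0 < L0) (delta_gt0 : 0 < delta)
    (xs : nat -> 'rV[R]_n) (xs_MPGN : MPGN_sequence C F LF L0 delta xs)
    (q fs : R) (q_gt0 : 0 < q)
    (f_KL : KL_property (objective C F) q (limit_points xs) fs) :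
  (2 <= q ->
     objective C F (xs k) @[k --> \oo] --> fs%:E /\
     exists (rho : R) (k0 : nat), 0 < rho < 1 /\
       forall k, (k0 <= k)%N ->
         (objective C F (xs k.+1) - fs%:E
            <= rho%:E * (objective C F (xs k) - fs%:E))%E)
  /\
  (q < 2 ->
     exists (c : R) (k0 : nat), [/\ 0 < c, (1 <= k0)%N &
       forall k, (k0 <= k)%N ->
         (0 <= objective C F (xs k) - fs%:E
            <= (c * k%:R `^ (- (q / (2 - q))))%:E)%E]).
Proof.
pose a k := norm2 (F (xs k)).
have ge_fs k : fs <= a k by exact: (MPGN_ge _ _ _ _ _ F_diff delta_gt0 _ xs_MPGN _ _ f_KL).
have fE k : objective C F (xs k) = (a k)%:E.
  by rewrite objectiveE//; exact: (MPGN_mem _ _ _ _ _ _ xs_MPGN).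
have [D [N [D0 rec]]] := MPGN_recursion _ _ _ _ _ C_closed C_convex
  F_diff LF_gt0 delta_gt0 F_lip _ xs_MPGN _ _ q_gt0 f_KL.
have decr k : a k.+1 <= a k.
  exact: (MPGN_nonincreasing _ _ _ _ _ delta_gt0 _ xs_MPGN).
split=> [q2|q2].
  split.
    under eq_fun do rewrite fE.
    apply/fine_cvgP; split; first by exists 0%N.
    exact: (MPGN_cvg _ _ _ _ _ F_diff delta_gt0 _ xs_MPGN _ _ f_KL).
  have D1 : 0 < 1 + D by rewrite addr_gt0.
  (* For q >= 2 the recursion has exponent 1 and rearranges to (1 + D) (a_{k+1} - fs) <= D (a_k -
     fs). *)
  exists (D / (1 + D)), N; split.
    by rewrite divr_gt0//= ltr_pdivrMr// mul1r ltrDr.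
  move=> k Nk; rewrite !fE -!EFinB -EFinM lee_fin mulrAC ler_pdivlMr//.
  have := rec k Nk; rewrite min_r// divff// powRr1 ?subr_ge0 ?decr//.
  rewrite -/(a k) -/(a k.+1); lra.
have [|||c [c0 cP]] := powR_rate R (fun k => a k - fs) D q N D0 q_gt0 q2.
- by move=> k; rewrite subr_ge0.
- by move=> k _; rewrite lerB.
- move=> k Nk; have := rec k Nk; rewrite min_l ?(ltW q2)//.
  by rewrite opprB subrKA.
exists c, (maxn N 1); split => //; first exact: leq_maxr.
by move=> k Nk; rewrite fE -EFinB !lee_fin subr_ge0 ge_fs/= cP.
Qed.
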